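(* Let $X$ be a connected, finite, simple $3$-valent (resp. $4$-valent) graph equipped with an orientation at each vertex, and for $k\geq 1$ let $X_k=\mathrm{GC}_{k,0}(X)$ be its Goldberg–Coxeter construction with parameters $(k,0)$, with $N_k=|V(X_k)|$ and Laplacian eigenvalues $\lambda_1(X_k)\leq\cdots\leq\lambda_{N_k}(X_k)$. Then for any sequence of positive integers $(m_k)_{k\geq1}$ with $m_k/k^2\to 0$ as $k\to\infty$, the first $m_k$ eigenvalues of $\Delta_{X_k}$ tend to $0$, i.e. $\lambda_{m_k}(X_k)\to 0$, and the last $m_k$ eigenvalues tend to $6$ (resp. $8$), i.e. $\lambda_{N_k-m_k+1}(X_k)\to 6$ in the $3$-valent case (resp. $\to 8$ in the $4$-valent case), as $k\to\infty$.
   Context: Graphs are connected, finite and simple. For a graph $Y$ the (combinatorial) Laplacian acts on $f\in\mathbb{C}^{V(Y)}$ by $(\Delta_Y f)(p)=\deg(p)f(p)-\sum_{q\sim p}f(q)$; its eigenvalues are listed with multiplicity in nondecreasing order. An orientation at each vertex of a $3$- or $4$-valent graph is a cyclic ordering of the edges emanating from each vertex. Goldberg–Coxeter construction ($3$-valent case): let $\omega=e^{\pi i/3}$, so $\mathbb{Z}[\omega]\subset\mathbb{C}$ is the triangular lattice, whose unit triangles are the upward triangles with vertices $a+b\omega,\ a+1+b\omega,\ a+(b+1)\omega$ and the downward triangles with vertices $a+b\omega,\ a+(b+1)\omega,\ a-1+(b+1)\omega$ ($a,b\in\mathbb{Z}$). For $(k,l)\in\mathbb{Z}^2\setminus\{(0,0)\}$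 put $z=k+l\omega$ and let $T$ be the triangle with vertices $0,z,\omega z$. For each $p\in V(X)$ take a copy $\overline{\triangle}(p)$ of the graph whose vertices are the barycenters of the unit lattice triangles meeting the interior of $T$, two barycenters being adjacent when the triangles share an edge; the three sides of $T$ are matched with the three edges at $p$ so that the given cyclic order at $p$ agrees with the counterclockwise order of the sides. For each edge $e=pq$ of $X$, place $\overline{\triangle}(p)$ on $T$ with $e$ corresponding to the side from $z$ to $\omega z$, and place $\overline{\triangle}(q)$ (preserving orientation) on the triangle with vertices $z,(1+\omega)z,\omega z$ with $e$ corresponding to the side from $\omega z$ to $z$; then identify all overlapping vertices and edges. The resulting $3$-valent graph is $\mathrm{GC}_{k,l}(X)$. ($4$-valent case): the same with $\mathbb{Z}[i]$ (square lattice with unit squares), $z=k+li$, the square $S$ with vertices $0,z,(1+i)z,iz$ in place of $T$, barycenters of unit squares meeting the interior of $S$, and for an edge $pq$ the piece of $q$ placed on the adjacent square across the side from $z$ to $(1+i)z$; the result is a $4$-valent graph $\mathrm{GC}_{k,l}(X)$. In particular $\mathrm{GC}_{k,0}(X)$ has $k^2|V(X)|$ vertices. *)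

(* Defs.v *)
From HB Require Import structures.
From mathcomp Require Import all_boot all_order all_algebra all_field.

Set Implicit Arguments.
Unset Strict Implicit.
Unset Printing Implicit Defensive.

Import Order.TTheory GRing.Theory Num.Theory.
Local Open Scope ring_scope.

Definition laplacian (V : finType) (e : rel V) : 'M[algC]_#|V| :=
  \matrix_(i, j)
    ((if i == j then (#|[pred y | e (enum_val i) y]|)%:R else 0)
     - (e (enum_val i) (enum_val j))%:R).

Definition spectrum n (A : 'M[algC]_n) : seq algC :=
  sort <=%R (sval (closed_field_poly_normal (char_poly A))).

(* lambda_i(Y), 1-indexed: lap_eig e i = lambda_i. *)
Definition lap_eig (V : finType) (e : rel V) (i : nat) : algC :=
  nth 0 (spectrum (laplacian e)) i.-1.

Definition cvg_seq (u : nat -> algC) (l : algC) : Prop :=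
  forall eps : algC, 0 < eps ->
    exists K : nat, forall k : nat, (K <= k)%N -> `|u k - l| < eps.

(* A finite simple connected d-valent graph with an orientation at each vertex
   is given by a rotation system nb : T -> 'I_d -> T: nb p 0, ..., nb p (d-1)
   are the neighbours of p (equivalently the edges at p, the graph being
   simple), listed in the cyclic order at p. *)
Definition adjX (d : nat) (T : finType) (nb : T -> 'I_d -> T) : rel T :=
  fun p q => [exists j, nb p j == q].

Definition oriented_regular (d : nat) (T : finType) (nb : T -> 'I_d -> T) : Prop :=
  [/\ (0 < #|T|)%N,
      forall p, injective (nb p),
      forall p j, nb p j != p,
      forall p j, exists j', nb (nb p j) j' = p
    & forall p q, connect (adjX nb) p q].

(* Piece: unit squares [a,a+1]x[b,b+1], 0 <= a, b < k, of S = [0,k]^2. *)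
Definition grid_adj (a b a' b' : nat) : bool :=
  (((a == a'.+1) || (a' == a.+1)) && (b == b'))
  || ((a == a') && ((b == b'.+1) || (b' == b.+1))).

(* The t-th square (t = 0..k-1, counted along the counterclockwise travel)
   along side j of S: side 0 = 0 -> z, 1 = z -> (1+i)z, 2 = (1+i)z -> iz,
   3 = iz -> 0  (z = k). *)
Definition sq_side (k : nat) (j : 'I_4) (t : nat) : nat * nat :=
  match val j with
  | 0 => (t, 0)
  | 1 => (k.-1, t)
  | 2 => (k.-1 - t, k.-1)
  | _ => (0, k.-1 - t)
  end%N.

(* Side j of the piece of p is matched with the edge {p, nb p j}.  Gluing the
   pieces of p and q = nb p j (with p = nb q j') by the half-turn about the
   midpoint of the common side makes the t-th square on side j of p adjacent
   to the (k-1-t)-th square on side j' of q. *)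
Definition gc4_rel (T : finType) (nb : T -> 'I_4 -> T) (k : nat)
  : rel (T * ('I_k * 'I_k)) :=
  fun x y =>
    let: (p, (a, b)) := x in
    let: (q, (a', b')) := y in
    ((p == q) && grid_adj a b a' b')
    || [exists j : 'I_4, exists j' : 'I_4, exists t : 'I_k,
          [&& nb p j == q, nb q j' == p,
              ((a : nat), (b : nat)) == sq_side k j t
            & ((a' : nat), (b' : nat)) == sq_side k j' (k.-1 - t)%N]].

(* Unit triangles of T = (0, k, k w): (true, a, b) is the upward triangle
   (a+bw, a+1+bw, a+(b+1)w), inside T iff a + b < k; (false, a, b) is the
   downward triangle (a+bw, a+(b+1)w, a-1+(b+1)w), inside T iff
   1 <= a and a + b < k.  There are k^2 of them. *)
Definition tri_valid (k : nat) (c : bool * 'I_k * 'I_k) : bool :=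
  let: (up, a, b) := c in
  if up then (a + b < k)%N else (0 < a)%N && (a + b < k)%N.

(* The upward triangle (a,b) shares an edge with the downward triangles
   (a+1,b-1), (a+1,b), (a,b). *)
Definition tri_ud (a b a' b' : nat) : bool :=
  ((a' == a.+1) && (b == b'.+1)) || ((a' == a.+1) && (b' == b))
  || ((a' == a) && (b' == b)).

Definition tri_int (k : nat) (c c' : bool * 'I_k * 'I_k) : bool :=
  let: (u, a, b) := c in
  let: (u', a', b') := c' in
  match u, u' with
  | true, false => tri_ud a b a' b'
  | false, true => tri_ud a' b' a b
  | _, _ => false
  end.

(* The t-th (upward) triangle along side j of T, counted along the
   counterclockwise travel: side 0 = 0 -> z, 1 = z -> wz, 2 = wz -> 0. *)
Definition tri_side (k : nat) (j : 'I_3) (t : nat) : nat * nat :=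
  match val j with
  | 0 => (t, 0)
  | 1 => (k.-1 - t, t)
  | _ => (0, k.-1 - t)
  end%N.

Definition gc3_rel (T : finType) (nb : T -> 'I_3 -> T) (k : nat)
  : rel (T * {c : bool * 'I_k * 'I_k | tri_valid c}) :=
  fun x y =>
    let: (p, c) := x in
    let: (q, c') := y in
    let: (u, a, b) := val c in
    let: (u', a', b') := val c' in
    ((p == q) && tri_int (val c) (val c'))
    || [exists j : 'I_3, exists j' : 'I_3, exists t : 'I_k,
          [&& nb p j == q, nb q j' == p, u, u',
              ((a : nat), (b : nat)) == tri_side k j t
            & ((a' : nat), (b' : nat)) == tri_side k j' (k.-1 - t)%N]].

Arguments gc4_rel T nb k : clear implicits.
Arguments gc3_rel T nb k : clear implicits.

(* Main.v *)
(* For every fixed [L], the piece of a single vertex of [X] contains disjoint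
   [L] x [L] blocks, in number at least [c_L k^2 >= m_k].  Every block is
   bipartite and, up to a proportion [O(1/L)] of its boundary, [d]-regular
   ([d = 3, 4]).  On the span of the indicator functions of the blocks the
   Rayleigh quotient of the Laplacian is [O(1/L)]; on the span of the same
   functions multiplied by the two-colouring of the blocks it is
   [2d - O(1/L)].  By Courant-Fischer, [m_k] eigenvalues lie within [O(1/L)] of
   [0], and [m_k] within [O(1/L)] of [2d]; all of them lie in [[0, 2d]].

   Both estimates come from the energies
   [E_s f = sum_(x ~ y) |f x + s f y|^2] for [s = 1, -1], summed over ordered
   pairs: the Laplacian has quadratic form [E_(-1) / 2], and
   [E_1 f + E_(-1) f <= 4 d |f|^2]. *)

Require Import Defs.
From HB Require Import structures.
From mathcomp Require Import all_boot all_order all_algebra all_field.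
From mathcomp Require Import ring zify.
Set Implicit Arguments.
Unset Strict Implicit.
Unset Printing Implicit Defensive.
Import Order.TTheory GRing.Theory Num.Theory.
Local Open Scope ring_scope.
Local Open Scope sesquilinear_scope.

(** * Courant-Fischer bounds for sorted spectra *)

(** Otherwise every entry from index [m] on exceeds [mu], leaving at most [m] entries below it. The
    order of [algC] is partial, so negating [<=] yields [>] only on reals. *)
Lemma sorted_nth_le (s : seq algC) (mu : algC) (m : nat) :
  all [in Num.real] s -> sorted <=%R s -> mu \is Num.real ->
  (m < count (fun x => (x <= mu)%R) s)%N -> nth 0 s m <= mu.
Proof.
move=> sR s_sorted muR m_lt.
have m_s : (m < size s)%N := leq_trans m_lt (count_size _ _).
have nR i : (i < size s)%N -> nth 0 s i \is Num.real.
  by move=> i_s; apply: (allP sR); rewrite mem_nth.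
rewrite real_leNgt ?nR //; apply/negP => mu_lt.
move: m_lt; rewrite -{1}(cat_take_drop m s) count_cat ltnNge => /negP; apply.
have -> : count (fun x => (x <= mu)%R) (drop m s) = 0%N; last first.
  by rewrite addn0; apply: leq_trans (count_size _ _) _; rewrite size_takel // ltnW.
apply/eqP; rewrite eqn0Ngt -has_count; apply/hasPn => x /(nthP 0)[i].
rewrite size_drop nth_drop => i_lt <-.
have mi_s : (m + i < size s)%N by rewrite -ltn_subRL.
rewrite -real_ltNge ?nR // (lt_le_trans mu_lt) //.
apply: (sorted_leq_nth_in (P := predT) _ _ 0) => //; rewrite ?all_predT ?leq_addr //.
by move=> y x0 z _ _ _; exact: le_trans.
Qed.

(** Mirror image: a failure at index [size s - m] leaves only the [m - 1] later entries to reach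
    [mu]. *)
Lemma sorted_nth_ge (s : seq algC) (mu : algC) (m : nat) :
  all [in Num.real] s -> sorted <=%R s -> mu \is Num.real ->
  (0 < m <= count (fun x => (mu <= x)%R) s)%N -> mu <= nth 0 s (size s - m).
Proof.
move=> sR s_sorted muR /andP[m_gt0 m_le].
have m_s : (m <= size s)%N := leq_trans m_le (count_size _ _).
have nR i : (i < size s)%N -> nth 0 s i \is Num.real.
  by move=> i_s; apply: (allP sR); rewrite mem_nth.
have sm_lt : (size s - m < size s)%N.
  by rewrite ltn_subrL m_gt0 (leq_trans m_gt0).
rewrite real_leNgt ?nR //; apply/negP => lt_mu.
move: m_le; rewrite -{1}(cat_take_drop (size s - m).+1 s) count_cat leqNgt.
move=> /negP; apply.
have -> : count (fun x => (mu <= x)%R) (take (size s - m).+1 s) = 0%N; last first.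
  rewrite add0n; apply: leq_ltn_trans (count_size _ _) _.
  by rewrite size_drop -[ltnRHS](subKn m_s) ltn_sub2l.
apply/eqP; rewrite eqn0Ngt -has_count; apply/hasPn => x /(nthP 0)[i].
rewrite size_takel // => i_lt; rewrite nth_take // => <-.
rewrite -real_ltNge ?nR ?(leq_trans i_lt) // (le_lt_trans _ lt_mu) //.
apply: (sorted_leq_nth_in (P := predT) _ _ 0) => //.
- by move=> y x0 z _ _ _; exact: le_trans.
- by rewrite all_predT.
- by rewrite inE (leq_trans i_lt).
Qed.

(** * Hermitian forms in an eigenbasis *)

Definition qform {n} (A : 'M[algC]_n) (v : 'rV[algC]_n) : algC :=
  (v *m A *m v ^t*) 0 0.

Section Spectrum.
Variables (n : nat) (A : 'M[algC]_n).
Hypothesis A_herm : A \is hermsymmx.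

Let P := spectralmx A.
Let D := spectral_diag A.

Lemma hermitian_spectral_decomposition : A = P ^t* *m diag_mx D *m P.
Proof.
rewrite {1}(orthomx_spectralP (hermitian_normalmx A_herm)).
by rewrite invmx_unitary ?spectral_unitarymx.
Qed.

Lemma char_poly_hermitian : char_poly A = \prod_(i < n) ('X - (D 0 i)%:P).
Proof.
have Pu : P \in unitmx := spectral_unit A.
have -> : char_poly A = char_poly (diag_mx D).
  rewrite /char_poly /char_poly_mx.
  have PK : map_mx polyC (invmx P) *m map_mx polyC P = 1%:M :> 'M[{poly algC}]_n.
    by rewrite -map_mxM mulVmx // map_mx1.
  have -> : 'X%:M - map_mx polyC A =
     map_mx polyC (invmx P) *m ('X%:M - map_mx polyC (diag_mx D)) *m map_mx polyC P.
    rewrite mulmxBr mulmxBl scalar_mxC -[X in _ = X - _]mulmxA PK mulmx1 -!map_mxM.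
    by rewrite [in LHS](orthomx_spectralP (hermitian_normalmx A_herm)).
  by rewrite !det_mulmx mulrAC -det_mulmx PK det1 mul1r.
rewrite char_poly_trig ?diag_mx_is_trig //.
by apply: eq_bigr => i _; rewrite mxE eqxx mulr1n.
Qed.

(** [spectrum] sorts the roots of an unspecified factorization; the characteristic polynomial also
    factors over the spectral diagonal, and the roots agree up to order. *)
Lemma perm_spectrum : perm_eq (spectrum A) [seq D 0 i | i <- enum 'I_n].
Proof.
rewrite /spectrum perm_sort; case: closed_field_poly_normal => r /=.
rewrite (monicP (char_poly_monic A)) scale1r char_poly_hermitian => rE.
apply: prod_XsubC_eq; rewrite -rE big_map big_enum.
by [].
Qed.

Lemma size_spectrum : size (spectrum A) = n.
Proof. by rewrite (perm_size perm_spectrum) size_map size_enum_ord. Qed.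

Lemma count_spectrum (a : pred algC) : count a (spectrum A) = #|[pred i | a (D 0 i)]|.
Proof.
rewrite (permP perm_spectrum) count_map -size_filter cardE.
by congr size; rewrite enumT.
Qed.

Lemma spectral_diag_real i : D 0 i \is Num.real.
Proof. exact: (mxOverP (hermitian_spectral_diag_real A_herm)). Qed.

Lemma spectrum_real : all [in Num.real] (spectrum A).
Proof.
rewrite (perm_all _ perm_spectrum); apply/allP => _ /mapP[i _ ->].
exact: spectral_diag_real.
Qed.

(** [<=] is total only on reals, so sorting relies on the reality of Hermitian eigenvalues. *)
Lemma spectrum_sorted : sorted <=%R (spectrum A).
Proof.
rewrite /spectrum; apply: (sort_sorted_in (P := [in Num.real])).
  by move=> x y xR yR; exact: real_comparable.
by rewrite -(perm_all _ (permEl (perm_sort <=%R _))) -/(spectrum A) spectrum_real.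
Qed.

Lemma qform_diag v : qform A v =
  \sum_i D 0 i * `|(v *m P ^t*) 0 i| ^+ 2.
Proof.
rewrite /qform hermitian_spectral_decomposition !mulmxA -mulmxA.
set w := v *m _.
have -> : P *m v ^t* = w ^t*.
  by rewrite /w trmx_mul map_mxM trmxCK.
rewrite mul_mx_diag mxE; apply: eq_bigr => i _.
by rewrite !mxE normCK mulrA [_ * D 0 i]mulrC.
Qed.

Lemma qform1_diag v : qform 1%:M v = \sum_i `|(v *m P ^t*) 0 i| ^+ 2.
Proof.
rewrite /qform mulmx1.
have -> : v *m v ^t* = (v *m P ^t*) *m (v *m P ^t*) ^t*.
  rewrite trmx_mul map_mxM trmxCK.
  by rewrite mulmxA mulmxKtV ?spectral_unitarymx.
by rewrite mxE; apply: eq_bigr => i _; rewrite !mxE normCK.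
Qed.

End Spectrum.

(** Fewer than [M] linear conditions on [M] unknowns: the columns in [Q] form a matrix with nonzero
    left kernel. *)
Lemma vanishing_combination {M n} (B : 'M[algC]_(M, n)) (Q : {pred 'I_n}) :
  (#|Q| < M)%N ->
  exists2 c : 'rV_M, c != 0 & forall i, i \in Q -> (c *m B) 0 i = 0.
Proof.
move=> QM; pose S := colsub (fun a : 'I_#|Q| => enum_val a) B.
have : kermx S != 0.
  rewrite -mxrank_eq0 mxrank_ker subn_eq0 -ltnNge.
  exact: leq_ltn_trans (rank_leq_col _) QM.
move=> /rowV0Pn[c /sub_kermxP cS c0]; exists c => // i iQ.
have := congr1 (fun X : 'rV_ _ => X 0 (enum_rank_in iQ i)) cS.
rewrite mulmx_colsub !mxE enum_rankK_in // => <-.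
Qed.

(** * Min-max comparison with a test subspace *)

Section MinMax.
Variables (n : nat) (A : 'M[algC]_n).
Hypothesis A_herm : A \is hermsymmx.

(* The sign [s] makes one statement cover both ends of the spectrum. *)
Lemma courant_fischer {M} (U : 'M[algC]_(M, n)) (s mu : algC) :
  s \is Num.real -> mu \is Num.real -> row_free U ->
  (forall c : 'rV_M, s * (qform A (c *m U) - mu * qform 1%:M (c *m U)) <= 0) ->
  (M <= #|[pred i | (s * (spectral_diag A 0%R i - mu) <= 0)%R]|)%N.
Proof.
(* If too few eigenvalues satisfy the inequality, some nonzero combination of the rows of [U] has
   zero coordinates along all their eigenvectors. *)
move=> sR muR Ufree form_le; rewrite leqNgt; apply/negP => /vanishing_combination.
move=> /(_ (U *m (spectralmx A) ^t*)) [c c0 wQ].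
have := form_le c; rewrite (qform1_diag A) qform_diag // mulr_sumr -sumrB mulr_sumr.
rewrite -mulmxA; set w := c *m _.
have termE i : s * (spectral_diag A 0 i * `|w 0 i| ^+ 2 - mu * `|w 0 i| ^+ 2) =
    s * (spectral_diag A 0 i - mu) * `|w 0 i| ^+ 2 by rewrite -mulrBl mulrA.
have sDR i : s * (spectral_diag A 0 i - mu) \is Num.real.
  by rewrite realM // realB // spectral_diag_real.
have w0 : w != 0.
  rewrite /w mulmxA mulmx_free_eq0; last first.
    by rewrite row_free_unit unitarymx_unit // trmxC_unitary spectral_unitarymx.
  by rewrite mulmx_free_eq0.
have [i wi0] : exists i, w 0 i != 0.
  apply/existsP; apply: contraNT w0 => /existsPn w0.
  by apply/eqP/rowP => i; rewrite [RHS]mxE; exact/eqP/negPn/w0.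
have sD_gt0 j : w 0 j != 0 -> 0 < s * (spectral_diag A 0 j - mu).
  move=> wj0; rewrite real_ltNge ?real0 //; apply: contraNN wj0 => sD_le0.
  by rewrite /w wQ ?inE.
rewrite (eq_bigr _ (fun j _ => termE j)) => sum_le0.
(* The surviving coordinates carry strictly positive factors and one of them is nonzero, against
   [form_le]. *)
suff : 0 < \sum_j s * (spectral_diag A 0 j - mu) * `|w 0 j| ^+ 2.
  by move=> /(le_lt_trans sum_le0); rewrite ltxx.
rewrite (bigD1 i) //= ltr_wpDr //; last first.
  by rewrite mulr_gt0 ?sD_gt0 // exprn_gt0 ?normr_gt0.
apply: sumr_ge0 => j _; have [->|wj0] := eqVneq (w 0 j) 0.
  by rewrite normr0 expr0n mulr0.
by rewrite mulr_ge0 ?exprn_ge0 // ltW // sD_gt0.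
Qed.

Lemma spectrum_nth_le {M} (U : 'M[algC]_(M, n)) (mu : algC) (m : nat) :
  mu \is Num.real -> row_free U ->
  (forall c : 'rV_M, qform A (c *m U) <= mu * qform 1%:M (c *m U)) ->
  (m < M)%N -> nth 0 (spectrum A) m <= mu.
Proof.
move=> muR Ufree form_le m_lt.
apply: sorted_nth_le => //; [exact: spectrum_real|exact: spectrum_sorted|].
rewrite count_spectrum //; apply: leq_trans m_lt _.
have -> : #|[pred i | (spectral_diag A 0%R i <= mu)%R]| =
          #|[pred i | (1 * (spectral_diag A 0%R i - mu) <= 0)%R]|.
  by apply: eq_card => i; rewrite !inE mul1r subr_le0.
by apply: (courant_fischer (U := U)) => // c; rewrite mul1r subr_le0.
Qed.

Lemma spectrum_nth_ge {M} (U : 'M[algC]_(M, n)) (mu : algC) (m : nat) :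
  mu \is Num.real -> row_free U ->
  (forall c : 'rV_M, mu * qform 1%:M (c *m U) <= qform A (c *m U)) ->
  (0 < m <= M)%N -> mu <= nth 0 (spectrum A) (n - m).
Proof.
move=> muR Ufree form_ge /andP[m_gt0 m_le].
rewrite -[in (n - m)%N](size_spectrum A_herm); apply: sorted_nth_ge => //.
- exact: spectrum_real.
- exact: spectrum_sorted.
rewrite m_gt0 count_spectrum //; apply: leq_trans m_le _.
have -> : #|[pred i | (mu <= spectral_diag A 0%R i)%R]| =
          #|[pred i | (-1 * (spectral_diag A 0%R i - mu) <= 0)%R]|.
  by apply: eq_card => i; rewrite !inE mulN1r opprB subr_le0.
apply: (courant_fischer (U := U)) => //; first by rewrite realN real1.
by move=> c; rewrite mulN1r opprB subr_le0.
Qed.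

(** The test space is the whole space. The lower bound counts from the top, so [m] is rewritten as
    [n - (n - m)]. *)
Lemma spectrum_nth_bounds (lo hi : algC) (m : nat) :
  lo \is Num.real -> hi \is Num.real ->
  (forall v, lo * qform 1%:M v <= qform A v <= hi * qform 1%:M v) ->
  (m < n)%N -> lo <= nth 0 (spectrum A) m <= hi.
Proof.
move=> loR hiR form m_lt.
have free1 : row_free (1%:M : 'M[algC]_n) by rewrite row_free_unit unitmx1.
apply/andP; split.
  rewrite -(subKn (ltnW m_lt)); apply: (spectrum_nth_ge loR free1).
    by move=> c; rewrite mulmx1; case/andP: (form c).
  by rewrite subn_gt0 m_lt leq_subr.
apply: (spectrum_nth_le hiR free1 _ m_lt) => c.
by rewrite mulmx1; case/andP: (form c).
Qed.

End MinMax.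

(** * The quadratic form of a graph Laplacian *)

Section LaplacianForm.
Variables (V : finType) (e : rel V) (d : nat).
Hypotheses (e_sym : symmetric e) (e_deg : forall x, (#|[pred y | e x y]| <= d)%N).
Implicit Types (f : V -> algC) (v : 'rV[algC]_#|V|).

Definition vfun v : V -> algC := fun x => v 0 (enum_rank x).

Definition sqnorm f : algC := \sum_x `|f x| ^+ 2.

(** The Boolean encodes the sign: [true] gives differences [f x - f y], [false] gives sums. *)
Definition energy (b : bool) f : algC :=
  \sum_x \sum_y (e x y)%:R * `|f x + (-1) ^+ b * f y| ^+ 2.

Let diag_part f : algC := \sum_x \sum_y (e x y)%:R * `|f x| ^+ 2.
Let cross_part f : algC := \sum_x \sum_y (e x y)%:R * (f x * (f y)^*).

Lemma sum_ord_enum_rank (F : 'I_#|V| -> algC) :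
  \sum_i F i = \sum_x F (enum_rank x).
Proof. by rewrite (reindex enum_rank) //=; exact/onW_bij/enum_rank_bij. Qed.

Lemma qform1_vfun v : qform 1%:M v = sqnorm (vfun v).
Proof.
rewrite /qform mulmx1 mxE sum_ord_enum_rank; apply: eq_bigr => x _.
by rewrite !mxE normCK.
Qed.

Let sum_adj x : \sum_y (e x y)%:R = #|[pred y | e x y]|%:R :> algC.
Proof.
rewrite -natr_sum -sum1_card [in RHS]big_mkcond /=.
by congr _%:R; apply: eq_bigr => y _; rewrite inE; case: (e x y).
Qed.

Let qform_laplacian_parts v :
  qform (laplacian e) v = diag_part (vfun v) - cross_part (vfun v).
Proof.
rewrite /qform mxE sum_ord_enum_rank /diag_part /cross_part.
under eq_bigr do rewrite mxE mulr_suml sum_ord_enum_rank.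
rewrite exchange_big -sumrB /=; apply: eq_bigr => x _.
rewrite -sumrB.
under eq_bigr do rewrite !mxE !enum_rankK mulrBr mulrBl.
rewrite !sumrB; congr (_ - _).
  rewrite (bigD1 x) //= eqxx big1 ?addr0 => [|y yx]; last first.
    by rewrite (can_eq enum_rankK) eq_sym (negPf yx) mulr0 mul0r.
  by rewrite -mulr_suml sum_adj mulrAC -normCK mulrC.
by apply: eq_bigr => y _; rewrite /vfun mulrCA mulrA.
Qed.

Let energy_parts b f :
  energy b f = 2 * diag_part f + (-1) ^+ b * (2 * cross_part f).
Proof.
have termE x y : `|f x + (-1) ^+ b * f y| ^+ 2 = `|f x| ^+ 2 + `|f y| ^+ 2
    + (-1) ^+ b * (f x * (f y)^* + f y * (f x)^* ).
  rewrite !normCK rmorphD rmorphM rmorphXn rmorphN1 /=.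
  by case: (b); rewrite ?expr1 ?expr0; ring.
rewrite /energy; under eq_bigr do under eq_bigr do rewrite termE !mulrDr.
under eq_bigr do rewrite !big_split /=.
rewrite !big_split /=.
rewrite [X in _ + X + _]exchange_big [X in _ + (_ + X)]exchange_big /=.
have -> : \sum_x \sum_y (e y x)%:R * `|f x| ^+ 2 = diag_part f.
  by apply: eq_bigr => x _; apply: eq_bigr => y _; rewrite e_sym.
have cE : \sum_x \sum_y (e x y)%:R * ((-1) ^+ b * (f x * (f y)^* )) =
    (-1) ^+ b * cross_part f.
  rewrite mulr_sumr; apply: eq_bigr => x _; rewrite mulr_sumr.
  by apply: eq_bigr => y _; rewrite mulrCA.
rewrite [X in _ + (_ + X)](_ : _ = (-1) ^+ b * cross_part f); last first.
  rewrite -cE; apply: eq_bigr => x _; apply: eq_bigr => y _.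
  by rewrite e_sym.
by rewrite cE -/(diag_part f); ring.
Qed.

Lemma energy_ge0 b f : 0 <= energy b f.
Proof.
by apply: sumr_ge0 => x _; apply: sumr_ge0 => y _; rewrite mulr_ge0 ?exprn_ge0.
Qed.

Lemma qform_laplacian v : qform (laplacian e) v = energy true (vfun v) / 2.
Proof.
by rewrite energy_parts qform_laplacian_parts expr1 mulN1r -mulrBr mulrC mulKf ?pnatr_eq0.
Qed.

(** Parallelogram law: each ordered edge contributes [2 |f x|^2 + 2 |f y|^2], which by symmetry of
    [e] totals four times the degree-weighted norm. *)
Lemma energy_sum_le f : energy true f + energy false f <= (4 * d)%:R * sqnorm f.
Proof.
have -> : energy true f + energy false f = 4 * diag_part f.
  by rewrite !energy_parts expr1 expr0; ring.
rewrite natrM -mulrA ler_wpM2l ?ler0n // /sqnorm mulr_sumr.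
apply: ler_sum => x _; rewrite -mulr_suml sum_adj.
by rewrite ler_wpM2r ?exprn_ge0 // ler_nat.
Qed.

Lemma laplacian_herm : laplacian e \is hermsymmx.
Proof.
apply/is_hermitianmxP; rewrite expr0 scale1r; apply/matrixP => i j.
rewrite !mxE rmorphB /= conjC_nat e_sym eq_sym; congr (_ - _).
by case: eqP => [->|_]; rewrite ?conjC0 ?conjC_nat.
Qed.

Lemma lap_nth_bounds m : (m < #|V|)%N ->
  0 <= nth 0 (spectrum (laplacian e)) m <= (2 * d)%:R.
Proof.
move=> m_lt; apply: spectrum_nth_bounds => //; first exact: laplacian_herm.
move=> v; rewrite mul0r qform_laplacian qform1_vfun.
rewrite divr_ge0 ?energy_ge0 ?ler0n //= ler_pdivrMr ?ltr0n //.
apply: le_trans (_ : energy true (vfun v) + energy false (vfun v) <= _).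
  by rewrite lerDl energy_ge0.
apply: le_trans (energy_sum_le _) _.
by rewrite mulrAC -natrM mulnAC.
Qed.

(** * Rayleigh quotients of test functions on disjoint blocks *)

Section Blocks.
(* [I] copies of the graph [(J, e0)], disjoint in [V]; the test functions are
   [c_i tau_j] on the [i]-th copy and [0] outside of the copies. *)
Variables (I J : finType) (e0 : rel J) (phi : I * J -> V).
Hypotheses (phi_inj : injective phi) (J_gt0 : (0 < #|J|)%N).
Hypothesis phi_edge : forall i j j', e0 j j' -> e (phi (i, j)) (phi (i, j')).

Let edges0 := #|[pred jj : J * J | e0 jj.1 jj.2]|.

Section TestFunctions.
Variables (b : bool) (tau : J -> algC).
Hypothesis tau_norm : forall j, `|tau j| = 1.
(** Along block edges the two terms in [energy b] reinforce each other: constant [tau] serves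
    [b = false], an alternating sign serves [b = true]. *)
Hypothesis tau_edge : forall j j', e0 j j' -> tau j' = (-1) ^+ b * tau j.

Let test_mx : 'M[algC]_(#|I|, #|V|) := \matrix_(a, x)
  if [pick p | phi p == enum_val x] is Some p
  then (enum_val a == p.1)%:R * tau p.2 else 0.

Let vfun_test_phi c i j :
  vfun (c *m test_mx) (phi (i, j)) = c 0 (enum_rank i) * tau j.
Proof.
rewrite /vfun mxE (bigD1 (enum_rank i)) //=.
rewrite big1 ?addr0 => [|a ai]; rewrite !mxE enum_rankK.
  by case: pickP => [p /eqP/phi_inj->|/(_ (i, j))]; rewrite /= ?enum_rankK eqxx ?mul1r.
case: pickP => [p /eqP/phi_inj->|]; rewrite ?mulr0 //=.
by rewrite -(can_eq enum_valK) enum_rankK in ai; rewrite (negPf ai) mul0r mulr0.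
Qed.

Let vfun_test_out c x : x \notin codom phi -> vfun (c *m test_mx) x = 0.
Proof.
move=> xphi; rewrite /vfun mxE big1 // => a _; rewrite mxE enum_rankK.
case: pickP => [p /eqP phip|]; rewrite ?mulr0 //.
by rewrite -phip codom_f in xphi.
Qed.

Let sum_codom_phi (F : V -> algC) : (forall x, x \notin codom phi -> F x = 0) ->
  \sum_x F x = \sum_i \sum_j F (phi (i, j)).
Proof.
move=> F0; rewrite pair_bigA (bigID [in [set phi p | p in setT]]) /=.
rewrite [X in _ + X]big1 ?addr0 => [|x xphi]; last first.
  by apply: F0; apply: contra xphi => /codomP[p ->]; rewrite imset_f ?inE.
rewrite big_imset => [|p q _ _ /phi_inj //].
by apply: eq_big => [p|[i j] _]; rewrite ?inE.
Qed.

Let sum_le_inj (K : finType) (h : K -> V) (F : V -> algC) :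
  injective h -> (forall x, 0 <= F x) -> \sum_k F (h k) <= \sum_x F x.
Proof.
move=> h_inj F0; rewrite (bigID [in [set h k | k in setT]]) /=.
rewrite big_imset => [|p q _ _ /h_inj //].
rewrite -[leLHS]addr0; apply: lerD; last by apply: sumr_ge0.
by rewrite le_eqVlt; apply/orP; left; apply/eqP/eq_bigl => k; rewrite inE.
Qed.

Let sqnorm_test (c : 'rV[algC]_#|I|) :
  sqnorm (vfun (c *m test_mx)) = #|J|%:R * \sum_a `|c 0 a| ^+ 2.
Proof.
rewrite /sqnorm sum_codom_phi => [|x xphi]; last first.
  by rewrite vfun_test_out // normr0 expr0n.
rewrite (reindex enum_rank) /=; last exact/onW_bij/enum_rank_bij.
rewrite mulr_sumr; apply: eq_bigr => i _.
under eq_bigr do rewrite vfun_test_phi normrM tau_norm mulr1.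
by rewrite sumr_const mulr_natl.
Qed.

(** By disjointness of the supports, a vanishing combination forces [sum |c_a|^2 = 0], as [J] is
    nonempty. *)
Let test_mx_free : row_free test_mx.
Proof.
rewrite -kermx_eq0; apply/rowV0P => c /sub_kermxP c0.
apply/rowP => a; rewrite mxE; apply/eqP; have := sqnorm_test c.
rewrite c0 [sqnorm _]big1 => [/esym/eqP|x _]; last first.
  by rewrite /vfun mxE normr0 expr0n.
rewrite mulf_eq0 pnatr_eq0 eqn0Ngt J_gt0 /= psumr_eq0 => [/allP/(_ a)|b' _].
  by rewrite mem_index_enum sqrf_eq0 normr_eq0 => /(_ isT).
by rewrite exprn_ge0.
Qed.

(** Dropping the nonnegative terms off the block edges lowers the energy; each remaining ordered
    pair contributes [|2 c_i tau_j|^2 = 4 |c_i|^2]. *)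
Let energy_test (c : 'rV[algC]_#|I|) :
  (4 * edges0)%:R * \sum_a `|c 0 a| ^+ 2 <= energy b (vfun (c *m test_mx)).
Proof.
set f := vfun _; pose F x := \sum_y (e x y)%:R * `|f x + (-1) ^+ b * f y| ^+ 2.
have F0 x : 0 <= F x by apply: sumr_ge0 => y _; rewrite mulr_ge0 ?exprn_ge0.
apply: le_trans (_ : \sum_p F (phi p) <= _); last exact: sum_le_inj.
rewrite (reindex enum_rank) /=; last exact/onW_bij/enum_rank_bij.
have -> : \sum_p F (phi p) = \sum_i \sum_j F (phi (i, j)).
  by rewrite [RHS]pair_bigA /=; apply: eq_bigr => -[].
rewrite mulr_sumr.
apply: ler_sum => i _; rewrite natrM.
have -> : edges0%:R = \sum_j \sum_j' (e0 j j')%:R :> algC.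
  rewrite pair_bigA /= -natr_sum /edges0 -sum1_card [in LHS]big_mkcond /=.
  by congr _%:R; apply: eq_bigr => p _; rewrite inE; case: (e0 _ _).
rewrite mulrAC mulr_sumr; apply: ler_sum => j _.
apply: le_trans (sum_le_inj (h := fun j' => phi (i, j')) _ _); first last.
- by move=> y; rewrite mulr_ge0 ?exprn_ge0.
- by move=> j1 j2 /phi_inj[].
rewrite mulr_sumr; apply: ler_sum => j' _.
case e0jj: (e0 j j'); last by rewrite mulr0 mulr_ge0 ?exprn_ge0.
rewrite phi_edge // mulr1 mul1r /f !vfun_test_phi (tau_edge e0jj).
rewrite [_ * (_ * tau j)]mulrCA signrMK -mulr2n.
by rewrite normrMn normrM tau_norm mulr1 exprMn_n mulr_natl.
Qed.

(** Twice the average degree of a block, since [edges0] counts ordered pairs. *)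
Let kappa : algC := (2 * edges0)%:R / #|J|%:R.

Let kappa_sqnorm_le c :
  kappa * qform 1%:M (c *m test_mx) <= energy b (vfun (c *m test_mx)) / 2.
Proof.
rewrite qform1_vfun sqnorm_test /kappa mulrA mulfVK ?pnatr_eq0 -?lt0n //.
rewrite ler_pdivlMr ?ltr0n // mulrAC -natrM [(2 * _ * 2)%N]mulnAC.
exact: energy_test.
Qed.

(** Half the energy of sums is at least [kappa] times the norm; by [energy_sum_le] at most
    [2d - kappa] remains for the Laplacian form. *)
Lemma lap_nth_block_le m : b = false -> (m < #|I|)%N ->
  nth 0 (spectrum (laplacian e)) m <= (2 * d)%:R - kappa.
Proof.
move=> b0; have kR : kappa \is Num.real by rewrite realM ?realV ?ger0_real ?ler0n.
apply: spectrum_nth_le test_mx_free _; first exact: laplacian_herm.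
  by rewrite realB // ger0_real ?ler0n.
move=> c; rewrite mulrBl lerBrDr qform_laplacian.
apply: le_trans (lerD (lexx _) (kappa_sqnorm_le c)) _.
rewrite b0 -mulrDl ler_pdivrMr ?ltr0n // qform1_vfun mulrAC -natrM.
by apply: le_trans (energy_sum_le _) _; rewrite mulnAC.
Qed.

(** For [b = true] the energy bounded below is twice the Laplacian form itself. *)
Lemma lap_nth_block_ge m : b = true -> (0 < m <= #|I|)%N ->
  kappa <= nth 0 (spectrum (laplacian e)) (#|V| - m).
Proof.
move=> b1; have kR : kappa \is Num.real by rewrite realM ?realV ?ger0_real ?ler0n.
apply: spectrum_nth_ge test_mx_free _ => //; first exact: laplacian_herm.
by move=> c; rewrite qform_laplacian -b1 kappa_sqnorm_le.
Qed.

End TestFunctions.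
End Blocks.
End LaplacianForm.

(** * Families of graphs with many almost regular blocks *)

Section Asymptotics.
Variables (d : nat) (V : nat -> finType) (e : forall k, rel (V k)).
Arguments e : clear implicits.
Hypothesis e_sym : forall k, symmetric (e k).
Hypothesis e_deg : forall k (x : V k), (#|[pred y | e k x y]| <= d)%N.

(* Up to [O(1/n)] the blocks [(J, e0)] are [d]-regular, and [V k] contains a
   positive proportion of its [O(k ^ 2)] vertices in disjoint copies of [J]. *)
Hypothesis blocks : forall n : nat,
  exists (J : finType) (e0 : rel J) (color : J -> bool) (c : nat) (K : nat),
    [/\ (0 < #|J|)%N,
        (d * n * #|J| <= #|[pred jj : J * J | e0 jj.1 jj.2]| * (n + 4))%N,
        forall j j', e0 j j' -> color j' = ~~ color j
      & forall k, (K <= k)%N ->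
        exists (I : finType) (phi : I * J -> V k),
          [/\ injective phi, (k ^ 2 <= c * #|I|)%N
            & forall i j j', e0 j j' -> e k (phi (i, j)) (phi (i, j'))]].

Variable m : nat -> nat.
Hypothesis m_gt0 : forall k, (0 < k)%N -> (0 < m k)%N.
Hypothesis m_small : cvg_seq (fun k => (m k)%:R / (k ^ 2)%:R) 0.

(** The block size is fixed first, from [eps]; then [k] is taken so large that more than [m k]
    blocks fit. *)
Let lap_eig_close (eps : algC) : 0 < eps -> exists K, forall k, (K <= k)%N ->
  (0 <= lap_eig (e k) (m k) < eps) /\
  ((2 * d)%:R - eps < lap_eig (e k) (#|V k| - m k).+1 <= (2 * d)%:R).
Proof.
move=> eps_gt0.
(* With [n > 8d / eps] the defect [2d - 2dn / (n + 4) = 8d / (n + 4)] is below [eps]. *)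
have boundE : (8 * d)%:R / eps < (Num.bound ((8 * d)%:R / eps : algC))%:R.
  by apply: archi_boundP; rewrite divr_ge0 ?ler0n // ltW.
set n := Num.bound _ in boundE.
have [J [e0 [color [c [K [J_gt0 J_edges colorP phiP]]]]]] := blocks n.
(* This threshold gives [m k * c.+1 < k ^ 2 <= c * #|I|], hence [m k < #|I|]; the successor also
   covers [c = 0]. *)
have [K' mK'] := m_small (eps := c.+1%:R^-1) ltac:(by rewrite invr_gt0 ltr0n).
pose kappa : algC := (2 * #|[pred jj : J * J | e0 jj.1 jj.2]|)%:R / #|J|%:R.
have kappa_close : (2 * d)%:R - eps < kappa.
  have n4 : (n + 4)%:R != 0 :> algC by rewrite pnatr_eq0 addn4.
  apply: lt_le_trans (_ : (2 * d * n)%:R / (n + 4)%:R <= _).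
    rewrite ltrBlDr -ltrBlDl.
    have -> : (2 * d)%:R - (2 * d * n)%:R / (n + 4)%:R = (8 * d)%:R / (n + 4)%:R :> algC.
      apply: (mulIf n4); rewrite mulrBl !mulfVK // -natrM -natrB; last first.
        by rewrite leq_mul2l leq_addr orbT.
      by congr _%:R; rewrite mulnDr addKn mulnAC.
    rewrite ltr_pdivrMr ?ltr0n ?addn4 // -ltr_pdivrMl // mulrC.
    by apply: lt_trans boundE _; rewrite ltr_nat -addn4 -addn1 leq_add2l.
  rewrite /kappa ler_pdivrMr ?ltr0n ?addn4 // mulrAC ler_pdivlMr ?ltr0n //.
  by rewrite -!natrM ler_nat -!mulnA leq_mul2l /= !mulnA -addn4.
exists (maxn 1 (maxn K K')) => k; rewrite !geq_max => /and3P[k_gt0 kK kK'].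
have [I [phi [phi_inj k_le phi_edge]]] := phiP k kK.
have mI : (m k < #|I|)%N.
  have := mK' k kK'; rewrite subr0 ger0_norm ?divr_ge0 ?ler0n //.
  rewrite ltr_pdivrMr ?ltr0n ?expn_gt0 ?k_gt0 // mulrC ltr_pdivlMr ?ltr0n //.
  rewrite -natrM ltr_nat => mc.
  have cI : (c * #|I| <= #|I| * c.+1)%N by rewrite mulnC leq_mul2l leqnSn orbT.
  by have := leq_trans mc (leq_trans k_le cI); rewrite ltn_pmul2r.
have IV : (#|I| <= #|V k|)%N.
  apply: leq_trans (leq_card _ phi_inj); rewrite card_prod.
  by rewrite leq_pmulr.
have mk_gt0 := m_gt0 k_gt0; have mV := leq_trans mI IV.
have bounds i : (i < #|V k|)%N -> 0 <= nth 0 (spectrum (laplacian (e k))) i <= (2 * d)%:R.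
  by apply: lap_nth_bounds; [exact: e_sym|exact: e_deg].
(* [lap_eig] is 1-indexed: the list positions are [(m k).-1] and [#|V k| - m k]. *)
rewrite /lap_eig /=; split.
  have pred_lt : ((m k).-1 < #|I|)%N := leq_ltn_trans (leq_pred _) mI.
  have /andP[-> _] /= := bounds _ (leq_trans pred_lt IV).
  apply: le_lt_trans (_ : (2 * d)%:R - kappa < eps); last first.
    by rewrite ltrBlDr -ltrBlDl.
  apply: (lap_nth_block_le (@e_sym k) (@e_deg k) phi_inj J_gt0 phi_edge
            (b := false) (tau := fun=> 1) _ _ (erefl _) pred_lt) => [j|j j' _].
    by rewrite normr1.
  by rewrite expr0 mul1r.
have /andP[_ ->] := bounds (#|V k| - m k)%N
  ltac:(by rewrite ltn_subrL mk_gt0 (leq_trans _ mV)).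
rewrite andbT; apply: lt_le_trans kappa_close _.
apply: (lap_nth_block_ge (@e_sym k) phi_inj J_gt0 phi_edge
          (b := true) (tau := fun j => (-1) ^+ color j)) => //.
- by move=> j; rewrite normrX normrN1 expr1n.
- by move=> j j' /colorP->; rewrite signrN expr1 mulN1r.
- by rewrite mk_gt0 ltnW.
Qed.

Lemma lap_eig_cvg :
  cvg_seq (fun k => lap_eig (e k) (m k)) 0 /\
  cvg_seq (fun k => lap_eig (e k) (#|V k| - m k).+1) (2 * d)%:R.
Proof.
split=> eps /lap_eig_close[K closeK]; exists K => k /closeK[/andP[lo0 lo] /andP[hi hi0]].
  by rewrite subr0 ger0_norm.
by rewrite distrC ger0_norm ?subr_ge0 // ltrBlDr -ltrBlDl.
Qed.

End Asymptotics.

(** * The tetravalent case *)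

(** Each of [d] directions reaches at most one vertex, so the neighbours lie in an image of ['I_d].
    Directions leading nowhere get the default [x], harmless for an upper bound. *)
Lemma card_adj_le (V : finType) (e : rel V) (d : nat) (step : V -> 'I_d -> pred V) :
  (forall x y, e x y -> exists j, step x j y) ->
  (forall x j y y', step x j y -> step x j y' -> y = y') ->
  forall x, (#|[pred y | e x y]| <= d)%N.
Proof.
move=> e_step step_inj x.
pose next j := odflt x [pick y | step x j y].
apply: leq_trans (_ : #|codom next| <= _)%N; last first.
  by apply: leq_trans (leq_image_card _ _) _; rewrite card_ord.
apply: subset_leq_card; apply/subsetP => y /e_step[j xjy].
apply/codomP; exists j; rewrite /next.
by case: pickP => [y' /(step_inj _ _ _ _ xjy)|/(_ y)/=]; last rewrite xjy.
Qed.

Lemma card_edges_ge (J Z : finType) (e0 : rel J) (h : Z -> J * J) :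
  injective h -> (forall z, e0 (h z).1 (h z).2) ->
  (#|Z| <= #|[pred jj : J * J | e0 jj.1 jj.2]|)%N.
Proof.
move=> h_inj h_edge; rewrite -(card_codom h_inj).
by apply: subset_leq_card; apply/subsetP => _ /codomP[z ->]; exact: h_edge.
Qed.

Section Square.
Variables (T : finType) (nb : T -> 'I_4 -> T).
Hypothesis nb_inj : forall p, injective (nb p).

(** The reversal [t -> k - 1 - t] is an involution, so a gluing reads the same from both ends. *)
Lemma gc4_sym k : symmetric (gc4_rel T nb k).
Proof.
suff imp : forall x y, gc4_rel T nb k x y -> gc4_rel T nb k y x.
  by move=> x y; apply/idP/idP; exact: imp.
case=> [p [a b]] [q [a' b']] /= /orP[/andP[/eqP-> adj]|].
  by rewrite eqxx /=; apply/orP; left; move: adj; rewrite /grid_adj; lia.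
move=> /existsP[j /existsP[j' /existsP[t /and4P[pq qp /eqP abE /eqP abE']]]].
apply/orP; right; apply/existsP; exists j'; apply/existsP; exists j.
apply/existsP; exists (rev_ord t); rewrite pq qp abE abE' /=.
have -> : (k - t.+1 = k.-1 - t)%N by lia.
have -> : (k.-1 - (k.-1 - t) = t)%N by have := ltn_ord t; lia.
by rewrite !eqxx.
Qed.

(** The square across side [j]: below, right, above, left, numbered as in [sq_side]. *)
Let move4 (j : 'I_4) (a b a' b' : nat) : bool :=
  match val j with
  | 0 => (a' == a) && (b == b'.+1)
  | 1 => (a' == a.+1) && (b' == b)
  | 2 => (a' == a) && (b' == b.+1)
  | _ => (a == a'.+1) && (b' == b)
  end%N.

Let step4 k (x : T * ('I_k * 'I_k)) (j : 'I_4) (y : T * ('I_k * 'I_k)) : bool :=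
  let: (p, (a, b)) := x in
  let: (q, (a', b')) := y in
  ((p == q) && move4 j a b a' b') ||
  [exists j' : 'I_4, exists t : 'I_k,
     [&& nb p j == q, nb q j' == p, ((a : nat), (b : nat)) == sq_side k j t
       & ((a' : nat), (b' : nat)) == sq_side k j' (k.-1 - t)%N]].

(** At most one neighbour per side: a square on side [j] of the piece has no inner neighbour across
    [j], it determines its position [t], and injectivity of [nb] at the adjacent vertex determines
    the matching side. *)
Lemma gc4_deg k x : (#|[pred y | gc4_rel T nb k x y]| <= 4)%N.
Proof.
apply: (card_adj_le (step := @step4 k)) => {x}.
  case=> [p [a b]] [q [a' b']] /= /orP[/andP[pq adj]|/existsP[j jP]]; last first.
    by exists j; rewrite jP orbT.
  suff [j jP] : exists j, move4 j a b a' b' by exists j; rewrite pq jP.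
  move: adj; rewrite /grid_adj => adj.
  have [?|?|?] := ltngtP a' a; [|by exists (inord 1); rewrite /move4 /= inordK //; lia|].
    by exists (inord 3); rewrite /move4 /= inordK //; lia.
  have [?|?|?] := ltngtP b' b; last by lia.
    by exists (inord 0); rewrite /move4 /= inordK //; lia.
  by exists (inord 2); rewrite /move4 /= inordK //; lia.
move=> [p [a b]] j [q [c1 c2]] [q' [c1' c2']] /=.
have ltk := (ltn_ord a, ltn_ord b, ltn_ord c1, ltn_ord c2, ltn_ord c1', ltn_ord c2').
have glue_move (t : 'I_k) (u v : 'I_k) : ((a : nat), (b : nat)) = sq_side k j t ->
    ~~ move4 j a b u v.
  move: (ltn_ord t) (ltn_ord u) (ltn_ord v).
  by case: j => [[|[|[|[|j]]]] ltj] //=; rewrite /sq_side /move4 /= => ? ? ? [-> ->]; lia.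
have side_inj (t t' : 'I_k) : sq_side k j t = sq_side k j t' -> t = t'.
  move: (ltn_ord t) (ltn_ord t') => ? ? tt'; apply: val_inj; move: tt'.
  by case: (j) => [[|[|[|[|j']]]] ltj] //=; rewrite /sq_side /= => -[]; lia.
have ord_eq (u1 v1 u2 v2 : 'I_k) :
    ((u1 : nat), (v1 : nat)) = ((u2 : nat), (v2 : nat)) -> (u1, v1) = (u2, v2).
  by case=> /val_inj-> /val_inj->.
case/orP=> [/andP[/eqP<- mv]|/existsP[j1 /existsP[t /and4P[/eqP<- q1 /eqP ab /eqP c12]]]].
- case/orP=> [/andP[/eqP<- mv']|/existsP[j1 /existsP[t /and4P[_ _ /eqP ab _]]]]; last first.
    by rewrite (negPf (glue_move _ _ _ ab)) in mv.
  congr (_, _); apply: ord_eq; move: mv mv'.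
  by case: (j) => [[|[|[|[|j']]]] ltj] //=; rewrite /move4 /= => ? ?; congr (_, _); lia.
- case/orP=> [/andP[_ mv']|/existsP[j2 /existsP[t' /and4P[/eqP<- q2 /eqP ab' /eqP c12']]]].
    by rewrite (negPf (glue_move _ _ _ ab)) in mv'.
  have tt' : t = t' by apply: side_inj; rewrite -ab.
  have jj : j1 = j2 by apply: (nb_inj (p := nb p j)); rewrite (eqP q1) (eqP q2).
  by congr (_, _); apply: ord_eq; rewrite c12 c12' tt' jj.
Qed.
End Square.

(** * Arithmetic of disjoint blocks in a piece *)

Section BlockArithmetic.
Variables (k L : nat).
Hypothesis k_ge : (2 * L <= k)%N.
(** The factor 2 keeps both coordinates below [k / 2], so the blocks also fit in the triangular
    piece. *)
Let r := (k %/ (2 * L))%N.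

(** As [r >= 1], [k < 2 L (r + 1) <= 4 L r]. *)
Lemma block_count : (0 < L)%N -> (k ^ 2 <= 16 * L ^ 2 * (r * r))%N.
Proof.
move=> L_gt0; have r_gt0 : (0 < r)%N by rewrite divn_gt0 // muln_gt0.
have k_lt : (k < r.+1 * (2 * L))%N by apply: ltn_ceil; rewrite muln_gt0.
have -> : (16 * L ^ 2 * (r * r) = (4 * L * r) ^ 2)%N by lia.
by rewrite leq_exp2r //; nia.
Qed.

Lemma block_coord_lt (i : 'I_r) (j : 'I_L) : ((i * L + j).*2 + 2 <= k)%N.
Proof.
have rk : (r * (2 * L) <= k)%N by exact: leq_divM.
by have := ltn_ord i; have := ltn_ord j; nia.
Qed.

Lemma block_coord_inj (i i' : 'I_r) (j j' : 'I_L) :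
  (i * L + j = i' * L + j')%N -> i = i' /\ j = j'.
Proof.
move=> ij; have L_gt0 : (0 < L)%N by apply: leq_ltn_trans (ltn_ord j).
split; apply: val_inj => /=.
  by have := congr1 (divn^~ L) ij; rewrite /= !divnMDl // !divn_small ?addn0.
by have := congr1 (modn^~ L) ij; rewrite /= !modnMDl !modn_small.
Qed.
End BlockArithmetic.

(** A block has [w] cells at each of [(n + 4)^2] positions, those at the [(n + 2)^2] inner ones
    having full degree [d]; the ratio follows from [n (n + 4) <= (n + 2)^2]. *)
Lemma edge_ratio (d w n E : nat) :
  (d * (w * (n.+2 * n.+2)) <= E)%N ->
  (d * n * (w * (n.+4 * n.+4)) <= E * (n + 4))%N.
Proof.
move=> E_ge; apply: leq_trans (leq_mul E_ge (leqnn (n + 4))).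
have -> : (d * n * (w * (n.+4 * n.+4)) = d * w * (n * n.+4) * (n + 4))%N by lia.
have -> : (d * (w * (n.+2 * n.+2)) * (n + 4) = d * w * (n.+2 * n.+2) * (n + 4))%N by lia.
by rewrite leq_mul2r leq_mul2l; apply/orP; right; apply/orP; right; lia.
Qed.

(** * Blocks in the square piece *)

Section SquareBlocks.
Variables (T : finType) (nb : T -> 'I_4 -> T) (p0 : T).

Let sq_adj n (u v : 'I_n * 'I_n) : bool := grid_adj u.1 u.2 v.1 v.2.

(** Cells with coordinates from 1 to [n + 2] have all four neighbours in the block. The lists in [h]
    are offsets from [(a, b)], while the cell itself is [(a + 1, b + 1)]. *)
Let sq_edges n :
  (4 * (n.+2 * n.+2) <= #|[pred jj | @sq_adj n.+4 jj.1 jj.2]|)%N.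
Proof.
pose h (z : 'I_4 * ('I_n.+2 * 'I_n.+2)) : ('I_n.+4 * 'I_n.+4) * ('I_n.+4 * 'I_n.+4) :=
  let: (j, (a, b)) := z in
  ((inord a.+1, inord b.+1),
   (inord (a + nth 0 [:: 1; 2; 1; 0] j), inord (b + nth 0 [:: 0; 1; 2; 1] j)))%N.
have -> : (4 * (n.+2 * n.+2) = #|{: 'I_4 * ('I_n.+2 * 'I_n.+2)}|)%N.
  by rewrite !card_prod !card_ord.
apply: (card_edges_ge (h := h)).
  move=> [[j ltj] [[a lta] [b ltb]]] [[j' ltj'] [[a' lta'] [b' ltb']]] /=.
  case=> /(congr1 val) /= aa /(congr1 val) /= bb /(congr1 val) /= xx /(congr1 val) /= yy.
  move: aa bb xx yy; rewrite !inordK; try by move: ltj ltj' => /=;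
    do 4?[case: j => [|j]] => //=; do 4?[case: j' => [|j']] => //=; lia.
  move=> [aa] [bb] xx yy; subst a' b'.
  have jj : j = j'.
    by move: ltj ltj' xx yy; do 4?[case: j => [|j]] => //=;
      do 4?[case: j' => [|j']] => //=; lia.
  by subst j'; congr (_, (_, _)); apply: val_inj.
move=> [[j ltj] [[a lta] [b ltb]]]; rewrite /h /sq_adj /grid_adj /=.
by move: ltj; do 4?[case: j => [|j]] => //= _; rewrite !inordK; lia.
Qed.

(** All blocks lie in the piece of [p0], coloured by the parity of the coordinate sum. *)
Lemma gc4_blocks (n : nat) :
  exists (J : finType) (e0 : rel J) (color : J -> bool) (c : nat) (K : nat),
    [/\ (0 < #|J|)%N,
        (4 * n * #|J| <= #|[pred jj : J * J | e0 jj.1 jj.2]| * (n + 4))%N,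
        forall j j', e0 j j' -> color j' = ~~ color j
      & forall k, (K <= k)%N ->
        exists (I : finType) (phi : I * J -> T * ('I_k * 'I_k)),
          [/\ injective phi, (k ^ 2 <= c * #|I|)%N
            & forall i j j', e0 j j' ->
                gc4_rel T nb k (phi (i, j)) (phi (i, j'))]].
Proof.
pose L := n.+4.
exists ('I_L * 'I_L)%type, (@sq_adj L), (fun u : 'I_L * 'I_L => odd (u.1 + u.2)).
exists (16 * L ^ 2)%N, (2 * L)%N; split.
- by rewrite card_prod card_ord.
- by rewrite card_prod card_ord -[(L * L)%N]mul1n edge_ratio // mul1n sq_edges.
- by move=> [a b] [a' b']; rewrite /sq_adj /grid_adj /=; lia.
move=> k k_ge; pose r := (k %/ (2 * L))%N.
have lt_k (i : 'I_r) (j : 'I_L) : (i * L + j < k)%N.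
  by have := block_coord_lt k_ge i j; move: (i * L + j)%N => x; lia.
exists ('I_r * 'I_r)%type, (fun ij : ('I_r * 'I_r) * ('I_L * 'I_L) =>
  (p0, (Ordinal (lt_k ij.1.1 ij.2.1), Ordinal (lt_k ij.1.2 ij.2.2)))); split.
- move=> [[i1 i2] [j1 j2]] [[i1' i2'] [j1' j2']] /= [].
  by move=> /block_coord_inj[-> ->] /block_coord_inj[-> ->].
- by rewrite card_prod !card_ord block_count.
- move=> [i1 i2] [a b] [a' b']; rewrite /sq_adj /= eqxx /= => adj.
  by apply/orP; left; move: adj; rewrite /grid_adj /=; lia.
Qed.
End SquareBlocks.

(** * The trivalent case *)

Section Triangle.
Variables (T : finType) (nb : T -> 'I_3 -> T).
Hypothesis nb_inj : forall p, injective (nb p).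

Local Notation cell k := {c : bool * 'I_k * 'I_k | tri_valid c}.

Lemma gc3_sym k : symmetric (gc3_rel T nb k).
Proof.
suff imp : forall x y, gc3_rel T nb k x y -> gc3_rel T nb k y x.
  by move=> x y; apply/idP/idP; exact: imp.
case=> [p [[[u a] b] v]] [q [[[u' a'] b'] v']] /=.
case/orP=> [/andP[/eqP-> adj]|].
  by rewrite eqxx /=; apply/orP; left; move: adj; case: (u); case: (u').
move=> /existsP[j /existsP[j' /existsP[t]]].
move=> /and5P[pq qp uT u'T /andP[/eqP abE /eqP abE']].
apply/orP; right; apply/existsP; exists j'; apply/existsP; exists j.
apply/existsP; exists (rev_ord t); rewrite pq qp uT u'T abE abE' /=.
have -> : (k - t.+1 = k.-1 - t)%N by lia.
have -> : (k.-1 - (k.-1 - t) = t)%N by have := ltn_ord t; lia.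
by rewrite !eqxx.
Qed.

(* The downward triangle across side [j] of the upward triangle [(a, b)]. *)
Let cross3 (j : 'I_3) (a b a' b' : nat) : bool :=
  match val j with
  | 0 => (a' == a.+1) && (b == b'.+1)
  | 1 => (a' == a.+1) && (b' == b)
  | _ => (a' == a) && (b' == b)
  end%N.

Let cross3P a b a' b' : tri_ud a b a' b' -> exists j, cross3 j a b a' b'.
Proof.
rewrite /tri_ud => /orP[/orP[]|] adj.
- by exists (inord 0); rewrite /cross3 /= inordK.
- by exists (inord 1); rewrite /cross3 /= inordK.
- by exists (inord 2); rewrite /cross3 /= inordK.
Qed.

(** Edges are labelled by the side of their upward triangle, so from a downward triangle [cross3]
    takes its arguments exchanged. *)
Let step3 k (x : T * cell k) (j : 'I_3) (y : T * cell k) : bool :=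
  let: (p, c) := x in
  let: (q, c') := y in
  let: (u, a, b) := val c in
  let: (u', a', b') := val c' in
  ((p == q) && match u, u' with
    | true, false => cross3 j a b a' b'
    | false, true => cross3 j a' b' a b
    | _, _ => false
    end) ||
  [exists j' : 'I_3, exists t : 'I_k,
     [&& nb p j == q, nb q j' == p, u, u', ((a : nat), (b : nat)) == tri_side k j t
       & ((a' : nat), (b' : nat)) == tri_side k j' (k.-1 - t)%N]].

(** As for squares. Across side [j] of the piece the downward triangle would lie outside it, by
    [tri_valid], so gluing and inner adjacency exclude each other. *)
Lemma gc3_deg k x : (#|[pred y | gc3_rel T nb k x y]| <= 3)%N.
Proof.
apply: (card_adj_le (step := @step3 k)) => {x}.
  case=> [p [[[u a] b] v]] [q [[[u' a'] b'] v']] /=.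
  case/orP=> [/andP[pq adj]|/existsP[j jP]]; last by exists j; rewrite jP orbT.
  rewrite pq; move: adj {v v'}.
  by case: u; case: u' => // /cross3P[j jP]; exists j; rewrite jP.
move=> [p [[[u a] b] v]] j [q [[[u1 a1] b1] v1]] [q' [[[u2 a2] b2] v2]] /=.
have side_cross (t a' b' : 'I_k) : (a' + b' < k)%N -> (0 < a')%N ->
    ((a : nat), (b : nat)) = tri_side k j t -> ~~ cross3 j a b a' b'.
  move: (ltn_ord t) (ltn_ord a') (ltn_ord b').
  by case: j => [[|[|[|j]]] ltj] //=; rewrite /tri_side /cross3 /= => ? ? ? ? ? [-> ->]; lia.
have side_inj (t t' : 'I_k) : tri_side k j t = tri_side k j t' -> t = t'.
  move: (ltn_ord t) (ltn_ord t') => ? ? tt'; apply: val_inj; move: tt'.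
  by case: (j) => [[|[|[|j']]] ltj] //=; rewrite /tri_side /= => -[]; lia.
have cell_eq q3 : u1 = u2 -> (a1 : nat) = a2 -> (b1 : nat) = b2 ->
    (q3, exist _ (u1, a1, b1) v1) = (q3, exist _ (u2, a2, b2) v2) :> T * cell k.
  move=> uu /val_inj aa /val_inj bb; congr (_, _); apply: val_inj => /=.
  by rewrite uu aa bb.
case/orP=> [/andP[/eqP<- mv]|].
- case/orP=> [/andP[/eqP<- mv']|].
    apply: cell_eq; move: mv mv'; case: (u); case: (u1); case: (u2) => //;
      by case: (j) => [[|[|[|j']]] ltj] //=; rewrite /cross3 /=; lia.
  move=> /existsP[j2 /existsP[t /and5P[_ _ uT _ /andP[/eqP ab _]]]].
  exfalso; have val1 : tri_valid (u1, a1, b1) := v1.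
  move: val1 mv; rewrite uT; case: (u1) => //= /andP[a1_gt0 lt_k].
  by rewrite (negPf (side_cross _ _ _ lt_k a1_gt0 ab)).
move=> /existsP[j1 /existsP[t /and5P[/eqP<- q1 uT u1T /andP[/eqP ab /eqP ab1]]]].
case/orP=> [/andP[_ mv]|].
  exfalso; have val2 : tri_valid (u2, a2, b2) := v2.
  move: val2 mv; rewrite uT; case: (u2) => //= /andP[a2_gt0 lt_k].
  by rewrite (negPf (side_cross _ _ _ lt_k a2_gt0 ab)).
move=> /existsP[j2 /existsP[t' /and5P[/eqP<- q2 _ u2T /andP[/eqP ab' /eqP ab2]]]].
have tt' : t = t' by apply: side_inj; rewrite -ab.
have jj : j1 = j2 by apply: (nb_inj (p := nb p j)); rewrite (eqP q1) (eqP q2).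
have : ((a1 : nat), (b1 : nat)) = ((a2 : nat), (b2 : nat)) by rewrite ab1 ab2 tt' jj.
by case=> ? ?; apply: cell_eq => //; rewrite u1T u2T.
Qed.

(** * Blocks in the triangular piece *)

Let tri_adj n (c c' : bool * 'I_n * 'I_n) : bool :=
  let: (u, a, b) := c in
  let: (u', a', b') := c' in
  match u, u' with
  | true, false => tri_ud a b a' b'
  | false, true => tri_ud a' b' a b
  | _, _ => false
  end.

(** The block is a rhombus with two triangles at each position; [da] and [db] list the offsets of
    the three neighbours of either kind. *)
Let tri_edges n :
  (3 * (2 * (n.+2 * n.+2)) <= #|[pred jj | @tri_adj n.+4 jj.1 jj.2]|)%N.
Proof.
pose da u := if u then [:: 2; 2; 1] else [:: 0; 0; 1]%N.
pose db u := if u then [:: 0; 1; 1] else [:: 2; 1; 1]%N.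
pose h (z : 'I_3 * (bool * ('I_n.+2 * 'I_n.+2))) :
    (bool * 'I_n.+4 * 'I_n.+4) * (bool * 'I_n.+4 * 'I_n.+4) :=
  let: (j, (u, (a, b))) := z in
  ((u, inord a.+1, inord b.+1),
   (~~ u, inord (a + nth 0 (da u) j), inord (b + nth 0 (db u) j)))%N.
have -> : (3 * (2 * (n.+2 * n.+2)) = #|{: 'I_3 * (bool * ('I_n.+2 * 'I_n.+2))}|)%N.
  by rewrite !card_prod !card_ord card_bool.
apply: (card_edges_ge (h := h)).
  move=> [[j ltj] [u [[a lta] [b ltb]]]] [[j' ltj'] [u' [[a' lta'] [b' ltb']]]] /=.
  case=> <- /(congr1 val) /= aa /(congr1 val) /= bb _ /(congr1 val) /= xx /(congr1 val) /= yy.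
  move: aa bb xx yy; rewrite !inordK; try by move: ltj ltj' => /=; case: u;
    do 3?[case: j => [|j]] => //=; do 3?[case: j' => [|j']] => //=; lia.
  move=> [aa] [bb] xx yy; subst a' b'.
  have jj : j = j'.
    by move: ltj ltj' xx yy; case: (u); do 3?[case: j => [|j]] => //=;
      do 3?[case: j' => [|j']] => //=; lia.
  by subst j'; congr (_, (_, (_, _))); apply: val_inj.
move=> [[j ltj] [u [[a lta] [b ltb]]]]; rewrite /h /tri_adj /tri_ud /=.
by move: ltj; case: u; do 3?[case: j => [|j]] => //= _; rewrite !inordK; lia.
Qed.

Variable p0 : T.

(** Adjacent triangles point in opposite directions, which gives the colouring. By [block_coord_lt]
    the shifted coordinates sum to at most [k - 1], so the cells are valid. *)
Lemma gc3_blocks (n : nat) :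
  exists (J : finType) (e0 : rel J) (color : J -> bool) (c : nat) (K : nat),
    [/\ (0 < #|J|)%N,
        (3 * n * #|J| <= #|[pred jj : J * J | e0 jj.1 jj.2]| * (n + 4))%N,
        forall j j', e0 j j' -> color j' = ~~ color j
      & forall k, (K <= k)%N ->
        exists (I : finType) (phi : I * J -> T * cell k),
          [/\ injective phi, (k ^ 2 <= c * #|I|)%N
            & forall i j j', e0 j j' ->
                gc3_rel T nb k (phi (i, j)) (phi (i, j'))]].
Proof.
pose L := n.+4.
exists (bool * 'I_L * 'I_L)%type, (@tri_adj L), (fun c : bool * 'I_L * 'I_L => c.1.1).
exists (16 * L ^ 2)%N, (2 * L)%N; split.
- by rewrite !card_prod card_ord card_bool.
- by rewrite !card_prod card_ord card_bool -[(2 * L * L)%N]mulnA edge_ratio ?tri_edges.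
- by move=> [[u a] b] [[u' a'] b']; case: u; case: u'.
move=> k k_ge; pose r := (k %/ (2 * L))%N.
have lt_a (i : 'I_r) (j : 'I_L) : ((i * L + j).+1 < k)%N.
  by have := block_coord_lt k_ge i j; move: (i * L + j)%N => x; lia.
have lt_b (i : 'I_r) (j : 'I_L) : (i * L + j < k)%N := ltnW (lt_a i j).
(* The shift by one in the first coordinate keeps the downward triangles
   inside the piece. *)
pose cell_of (i : 'I_r * 'I_r) (c : bool * 'I_L * 'I_L) : bool * 'I_k * 'I_k :=
  (c.1.1, Ordinal (lt_a i.1 c.1.2), Ordinal (lt_b i.2 c.2)).
have cell_valid i c : tri_valid (cell_of i c).
  have := block_coord_lt k_ge i.1 c.1.2; have := block_coord_lt k_ge i.2 c.2.
  rewrite /cell_of /=; move: (i.1 * L + _)%N (i.2 * L + _)%N => x y.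
  by case: c.1.1; lia.
exists ('I_r * 'I_r)%type, (fun ic =>
  (p0, exist (fun c => is_true (tri_valid c)) _ (cell_valid ic.1 ic.2))); split.
- move=> [[i1 i2] [[u a] b]] [[i1' i2'] [[u' a'] b']] [] <-.
  by move=> /block_coord_inj[-> ->] /block_coord_inj[-> ->].
- by rewrite card_prod !card_ord block_count.
- move=> [i1 i2] [[u a] b] [[u' a'] b']; rewrite /tri_adj /= eqxx /= => adj.
  by apply/orP; left; move: adj; case: u; case: u' => //; rewrite /tri_ud /=; lia.
Qed.
End Triangle.

Theorem theorem1p1 :
  (forall (T : finType) (nb : T -> 'I_3 -> T), oriented_regular nb ->
   forall m : nat -> nat, (forall k, (0 < k)%N -> (0 < m k)%N) ->
   cvg_seq (fun k => (m k)%:R / (k ^ 2)%:R) 0 ->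
   cvg_seq (fun k => lap_eig (gc3_rel T nb k) (m k)) 0 /\
   cvg_seq (fun k => lap_eig (gc3_rel T nb k)
                        (#|{: T * {c : bool * 'I_k * 'I_k | tri_valid c}}| - m k).+1) 6)
  /\
  (forall (T : finType) (nb : T -> 'I_4 -> T), oriented_regular nb ->
   forall m : nat -> nat, (forall k, (0 < k)%N -> (0 < m k)%N) ->
   cvg_seq (fun k => (m k)%:R / (k ^ 2)%:R) 0 ->
   cvg_seq (fun k => lap_eig (gc4_rel T nb k) (m k)) 0 /\
   cvg_seq (fun k => lap_eig (gc4_rel T nb k) (#|{: T * ('I_k * 'I_k)}| - m k).+1) 8).
Proof.
split=> T nb [/card_gt0P[p0 _] nb_inj _ _ _] m m_gt0 m_small.
  apply: (lap_eig_cvg (d := 3) (e := fun k => gc3_rel T nb k)) => // [k|k x|n].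
  - exact: gc3_sym.
  - exact: gc3_deg.
  - exact: gc3_blocks.
apply: (lap_eig_cvg (d := 4) (e := fun k => gc4_rel T nb k)) => // [k|k x|n].
- exact: gc4_sym.
- exact: gc4_deg.
- exact: gc4_blocks.
Qed.
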